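(* Let $\Gamma=\langle V,(w_u)_{u\in V},\alpha,\beta\rangle$ be a star celebrity game with $\beta>1$. For every Nash equilibrium $S$ of $\Gamma$ whose outcome graph $G[S]$ is a tree, $C(S)\le 2\,\mathrm{opt}(\Gamma)$.
   Context: A celebrity game $\Gamma=\langle V,(w_u)_{u\in V},\alpha,\beta\rangle$ consists of a set of players $V=\{1,\dots,n\}$, celebrity weights $w_u>0$, a link cost $\alpha>0$ and a critical distance $\beta$ with $1\le\beta\le n-1$. A strategy of player $u$ is a set $S_u\subseteq V\setminus\{u\}$; a strategy profile is $S=(S_1,\dots,S_n)$; its outcome graph $G[S]$ is the undirected graph on $V$ with edge set $\{\{u,v\}: u\in S_v\text{ or }v\in S_u\}$. With $d_G$ the graph distance (infinite between different connected components), the cost of player $u$ is $c_u(S)=\alpha|S_u|+\sum_{v:\,d_{G[S]}(u,v)>\beta}w_v$ and the social cost is $C(S)=\sum_{u\in V}c_u(S)$. $S$ is a Nash equilibrium (NE) if no player can strictly decrease its cost by changing only its own strategy; a graph is an NE graph if it equals $G[S]$ for some NE $S$. $\mathrm{opt}(\Gamma)=\min_S C(S)$. $\Gamma$ is a star celebrity game if it has an NE graph that is connected. *)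

(* Defs.v *)
From mathcomp Require Import all_boot all_order all_algebra.
Set Implicit Arguments. Unset Strict Implicit. Unset Printing Implicit Defensive.
Import Order.TTheory GRing.Theory Num.Theory.
Local Open Scope ring_scope.

(* A strategy profile: S u is the set of players u buys links to. *)
Definition profile (n : nat) := 'I_n -> {set 'I_n}.

Definition valid_profile n (S : profile n) : Prop := forall u, u \notin S u.

Definition adj n (S : profile n) : rel 'I_n :=
  fun u v => (u \in S v) || (v \in S u).

(* within S k u v  <=>  d_{G[S]}(u,v) <= k *)
Fixpoint within n (S : profile n) (k : nat) (u v : 'I_n) : bool :=
  match k with
  | 0 => u == v
  | k'.+1 => within S k' u v || [exists x, adj S u x && within S k' x v]
  end.

Definition cost (R : numDomainType) n (w : 'I_n -> R) (alpha : R) (beta : nat)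
    (S : profile n) (u : 'I_n) : R :=
  alpha * (#|S u|)%:R + \sum_(v | ~~ within S beta u v) w v.

Definition social_cost (R : numDomainType) n (w : 'I_n -> R) (alpha : R)
    (beta : nat) (S : profile n) : R :=
  \sum_(u < n) cost w alpha beta S u.

Definition deviate n (S : profile n) (u : 'I_n) (T : {set 'I_n}) : profile n :=
  fun x => if x == u then T else S x.

Definition nash_eq (R : numDomainType) n (w : 'I_n -> R) (alpha : R)
    (beta : nat) (S : profile n) : Prop :=
  valid_profile S /\
  forall (u : 'I_n) (T : {set 'I_n}), u \notin T ->
    cost w alpha beta S u <= cost w alpha beta (deviate S u T) u.

Definition connected_graph n (S : profile n) : Prop :=
  forall u v : 'I_n, connect (adj S) u v.

Definition acyclic_graph n (S : profile n) : Prop :=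
  forall s : seq 'I_n, uniq s -> (3 <= size s)%N -> ~~ cycle (adj S) s.

Definition is_tree n (S : profile n) : Prop :=
  connected_graph S /\ acyclic_graph S.

Definition star_celebrity_game (R : numDomainType) n (w : 'I_n -> R)
    (alpha : R) (beta : nat) : Prop :=
  exists S : profile n, nash_eq w alpha beta S /\ connected_graph S.

(* Main.v *)
(** The optimum is at least [alpha * (n - 1)]: with [r] components a profile
    needs [n - r] links, and each vertex is missed by at least [r - 1] players,
    which costs [(r - 1) W] for the total weight [W >= alpha].

    In a tree equilibrium every link is paid once, so links cost at most
    [alpha * (n - 1)].  The diameter is at most [beta + 1]: two leaves further
    than [beta] apart cannot both pay for their own link, since each of them
    could imitate the other; so one of them, [x], has weight at least [alpha],
    and if the distance were [beta + 2] the other would gain by linking to the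
    neighbour of [x].  All vertices far from [u] then share the first two steps
    of their path from [u], so linking to the second one reaches them all, hence
    they weigh at most [alpha].  Finally the neighbour of a leaf has no far
    vertex, so the far weights also add up to at most [alpha * (n - 1)]. *)
Require Import Defs.
From mathcomp Require Import all_boot all_order all_algebra.
From mathcomp Require Import zify lra.
Set Implicit Arguments. Unset Strict Implicit. Unset Printing Implicit Defensive.
Import Order.TTheory GRing.Theory Num.Theory.
Local Open Scope ring_scope.

(* The value is [n] when [u] and [v] are not connected. *)
Definition dist n (S : profile n) (u v : 'I_n) : nat :=
  find (fun k => within S k u v) (iota 0 n).

Definition leaf n (S : profile n) (x p : 'I_n) : Prop :=
  forall z, adj S x z = (z == p).

(** * Walks and graph distance *)

Lemma adj_sym n (S : profile n) : symmetric (adj S).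
Proof. by move=> u v; rewrite /adj orbC. Qed.

Lemma adj_irr n (S : profile n) u : valid_profile S -> adj S u u = false.
Proof. by move=> vS; rewrite /adj orbb (negbTE (vS u)). Qed.

Lemma connect_adj_sym n (S : profile n) : connect_sym (adj S).
Proof. exact: sym_connect_sym (adj_sym S). Qed.

Lemma within_refl n (S : profile n) k u : within S k u u.
Proof. by elim: k => [|k IH] /=; [exact: eqxx | rewrite IH]. Qed.

Lemma within_leq n (S : profile n) j k u v :
  (j <= k)%N -> within S j u v -> within S k u v.
Proof.
move=> jk; rewrite -(subnK jk); elim: (k - j)%N => [|i IH] // H.
by rewrite addSn /= IH.
Qed.

Lemma within_step n (S : profile n) k u x v :
  adj S u x -> within S k x v -> within S k.+1 u v.
Proof. by move=> ux xv /=; apply/orP; right; apply/existsP; exists x; rewrite ux. Qed.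

Lemma within_ind_step n (S : profile n) k u v : within S k.+1 u v ->
  within S k u v \/ exists2 x, adj S u x & within S k x v.
Proof.
by move=> /= /orP[|/existsP[x /andP[]]]; [left | right; exists x].
Qed.

Lemma within_trans n (S : profile n) j k u x v :
  within S j u x -> within S k x v -> within S (j + k) u v.
Proof.
move=> + xv; elim: j u => [|j IH] u; first by move=> /eqP->.
case/within_ind_step => [/IH|[y uy /IH]]; first by apply: within_leq; lia.
by rewrite addSn; apply: within_step.
Qed.

Lemma within_sym n (S : profile n) k u v : within S k u v -> within S k v u.
Proof.
elim: k u => [|k IH] u; first by rewrite /= eq_sym.
case/within_ind_step => [/IH|[x ux /IH vx]]; first exact: within_leq.
rewrite -addn1; apply: within_trans vx _.
by apply: within_step (within_refl S 0 u); rewrite adj_sym.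
Qed.

Lemma within_sub n (S S' : profile n) k u v :
  (forall a b, adj S a b -> adj S' a b) -> within S k u v -> within S' k u v.
Proof.
move=> sub; elim: k u => [|k IH] u //.
case/within_ind_step => [/IH|[x /sub ux /IH]]; first exact: within_leq.
exact: within_step.
Qed.

Lemma within_connect n (S : profile n) k u v :
  within S k u v -> connect (adj S) u v.
Proof.
elim: k u => [|k IH] u; first by move=> /eqP->.
by case/within_ind_step => [/IH|[x /connect1 ux /IH]] //; apply: connect_trans.
Qed.

(** A path without repeated vertices has fewer than [n] edges, so the search range [iota 0 n] in
    [dist] is long enough. *)
Lemma connect_within n (S : profile n) u v :
  connect (adj S) u v -> exists2 k, (k < n)%N & within S k u v.
Proof.
case/connectP => p up ->; case/shortenP: up => q uq uniq_q _.
exists (size q).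
  by have := max_card (mem (u :: q)); rewrite (card_uniqP uniq_q) card_ord.
elim: q u uq {uniq_q} => [|x q IH] u /=; first by rewrite eqxx.
by case/andP => ux /IH; apply: within_step.
Qed.

(** Connectedness excludes the default value [n] of [dist], which would pass the test on the right
    for every [k >= n]. *)
Lemma withinE n (S : profile n) k u v :
  connect (adj S) u v -> within S k u v = (dist S u v <= k)%N.
Proof.
move=> uv; have [j jn ujv] := connect_within uv.
have H : has (fun k => within S k u v) (iota 0 n).
  by apply/hasP; exists j; rewrite // mem_iota.
have dn : (dist S u v < n)%N by move: H; rewrite has_find size_iota.
apply/idP/idP => [ukv|dk].
  rewrite leqNgt; apply/negP => kd.
  have := before_find 0 kd; rewrite nth_iota ?add0n ?ukv //.
  exact: ltn_trans dn.
apply: within_leq dk _.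
by have := nth_find 0 H; rewrite nth_iota.
Qed.

Lemma dist_eq0 n (S : profile n) u v :
  connect (adj S) u v -> (dist S u v == 0)%N = (u == v).
Proof. by move=> uv; rewrite -leqn0 -withinE. Qed.

Lemma dist_pred n (S : profile n) u v : connect (adj S) u v -> u != v ->
  exists2 x, adj S u x & dist S u v = (dist S x v).+1.
Proof.
move=> uv; rewrite -(@dist_eq0 _ S) //.
case E: (dist S u v) => [|k] // _.
have /within_ind_step[|[x ux xv]] : within S k.+1 u v by rewrite withinE ?E.
  by rewrite withinE // E ltnn.
exists x => //; have cxv := within_connect xv.
congr _.+1; apply/eqP; rewrite eqn_leq andbC -withinE // xv /= -ltnS -E.
by rewrite -withinE //; apply: within_step ux _; rewrite withinE.
Qed.

Lemma dist_adj n (S : profile n) u x v : connect (adj S) x v -> adj S u x ->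
  (dist S u v <= (dist S x v).+1)%N.
Proof.
move=> xv ux; rewrite -withinE ?(connect_trans (connect1 ux)) //.
by apply: within_step ux _; rewrite withinE.
Qed.

Lemma dist_sym n (S : profile n) u v :
  connected_graph S -> dist S u v = dist S v u.
Proof.
move=> cS; apply/eqP; rewrite eqn_leq -!withinE //.
by apply/andP; split; apply: within_sym; rewrite withinE.
Qed.

(** * Geodesics and leaves in trees *)

(* Otherwise [y] and [z] would be joined, through [r], by a path avoiding [t]. *)
Lemma unique_parent n (S : profile n) r t y z :
  valid_profile S -> is_tree S -> adj S t y -> adj S t z ->
  (dist S y r <= dist S t r)%N -> (dist S z r <= dist S t r)%N -> y = z.
Proof.
move=> vS [cS aS] ty tz yr zr; apply/eqP/negPn/negP => yz.
(* [e] is the graph with the vertex [t] deleted. *)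
pose e := [rel a b | [&& adj S a b, a != t & b != t]].
have es : symmetric e by move=> a b; rewrite /= adj_sym [(a != t) && _]andbC.
(* Along a geodesic to [r], every vertex after [a] is strictly nearer to [r] than [t] is, so the
   geodesic avoids [t]. *)
have toroot a : a != t -> (dist S a r <= dist S t r)%N -> connect e a r.
  move E: (dist S a r) => k; elim: k a E => [|k IH] a E nat_ le.
    by move/eqP: E; rewrite dist_eq0 // => /eqP->.
  have nar : a != r by rewrite -(@dist_eq0 _ S) // E.
  have [x ax] := dist_pred (cS a r) nar; rewrite E => -[Ex].
  have nxt : x != t by apply/eqP => xt; move: le; rewrite -xt -Ex ltnn.
  apply: connect_trans (connect1 _) (IH x _ nxt _); rewrite //= ?ax ?nat_ ?nxt //.
  exact: ltnW.
have neq a : adj S t a -> a != t by case: eqP => // ->; rewrite adj_irr.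
have : connect e y z.
  apply: connect_trans (toroot y _ yr) _; first exact: neq.
  by rewrite sym_connect_sym //; apply: toroot zr; apply: neq.
case/connectP => p yp zE; move: yz tz; rewrite zE {zE zr z}.
case/shortenP: yp => q yq uq _ yz tz.
have qt : t \notin q.
  elim: q (y) yq {uq yz tz} => // a q IH b /= /andP[/and3P[_ _ nat_] /IH].
  by rewrite inE negb_or eq_sym nat_.
have uniq_c : uniq [:: t, y & q].
  by move: uq; rewrite /= inE negb_or qt andbT eq_sym neq.
have := aS _ uniq_c; rewrite /= rcons_path ty /= => /(_ _)/negP.
case; first by case: (q) yz => //=; rewrite eqxx.
rewrite adj_sym tz andbT.
by apply: sub_path yq => a b /and3P[].
Qed.

Lemma farther n (S : profile n) r t y z :
  valid_profile S -> is_tree S -> adj S t y -> adj S t z -> y != z ->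
  (dist S y r <= dist S t r)%N -> dist S z r = (dist S t r).+1.
Proof.
move=> vS tS ty tz yz yr; apply/eqP; rewrite eqn_leq.
rewrite dist_adj ?(proj1 tS) 1?adj_sym //= ltnNge.
by apply: contra yz => zr; apply/eqP; apply: unique_parent yr zr.
Qed.

(** No neighbour of [x] is farther from [r] than [x], and a tree allows only one such neighbour. *)
Lemma leaf_farthest n (S : profile n) r x :
  valid_profile S -> is_tree S -> x != r ->
  (forall z, dist S z r <= dist S x r)%N -> exists p, leaf S x p.
Proof.
move=> vS tS xr xmax; have [p xp _] := dist_pred (proj1 tS x r) xr.
exists p => z; apply/idP/eqP => [xz|->] //.
exact: unique_parent (xmax z) (xmax p).
Qed.

(* Once a geodesic towards [z] steps away from [r], it never turns back. *)
Lemma geodesic_away n (S : profile n) r a b z :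
  valid_profile S -> is_tree S -> adj S a b ->
  dist S b r = (dist S a r).+1 -> dist S a z = (dist S b z).+1 ->
  dist S z r = (dist S a r + dist S a z)%N.
Proof.
move=> vS tS; have cS := proj1 tS.
move E: (dist S b z) => k; elim: k a b E => [|k IH] a b E ab br az.
  by move/eqP: E; rewrite dist_eq0 // => /eqP bz; rewrite az addn1 -br bz.
have nbz : b != z by rewrite -(@dist_eq0 _ S) // E.
have [c bc] := dist_pred (cS b z) nbz; rewrite E => -[Ec].
have cr : dist S c r = (dist S b r).+1.
  apply: (@farther _ _ _ _ a); rewrite ?br // 1?adj_sym //.
  by apply/eqP => ac; move: az; rewrite ac -Ec; lia.
rewrite (IH b c) ?E ?Ec //; lia.
Qed.

Lemma within_leaf n (S : profile n) k x p v :
  leaf S x p -> v != x -> within S k x v -> within S k.-1 p v.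
Proof.
move=> lx vx; elim: k => [|k IH]; first by rewrite /= eq_sym (negbTE vx).
case/within_ind_step => [/IH|[z]]; first by apply: within_leq; rewrite leq_pred.
by rewrite lx => /eqP->.
Qed.

(** A visit to the leaf [x] returns at once to [p], so it can be cut out of the walk; hence the
    links at [x] may change freely. *)
Lemma within_avoid_leaf n (S S' : profile n) k x p z v :
  leaf S x p ->
  (forall a b, a != x -> b != x -> adj S a b -> adj S' a b) ->
  z != x -> v != x -> within S k z v -> within S' k z v.
Proof.
move=> lx sub + vx; elim: k z => [|k IH] z zx //.
case/within_ind_step => [/IH H|[y zy]]; first exact: within_leq (H zx).
have [yE|yx] := eqVneq y x; last first.
  by move=> /(IH y yx); apply: within_step; apply: sub.
move: zy; rewrite yE adj_sym lx => /eqP zp /(within_leaf lx vx).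
rewrite -zp => /(within_leq (leq_pred k)) /(IH z zx).
exact: within_leq.
Qed.

(** * Inequalities from unilateral deviations *)

(** Compares weights by the multiplicity with which each vertex is counted; [xpred0] fills an empty
    slot when one side has a single sum. *)
Lemma ler_sum_pred2 (R : realFieldType) (I : finType) (w : I -> R)
    (P P' Q Q' : pred I) : (forall v, 0 < w v) ->
  (forall v, (P v + P' v <= Q v + Q' v)%N) ->
  \sum_(v | P v) w v + \sum_(v | P' v) w v <=
  \sum_(v | Q v) w v + \sum_(v | Q' v) w v.
Proof.
move=> w0 le.
have indicator (A : pred I) : \sum_(v | A v) w v = \sum_v w v *+ A v.
  by rewrite big_mkcond; apply: eq_bigr => v _; rewrite mulrb.
rewrite !indicator -!big_split /=; apply: ler_sum => v _.
by rewrite -!mulrnDr -[leLHS]mulr_natr -[leRHS]mulr_natr ler_pM2l ?ler_nat.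
Qed.

Lemma deviate_same n (S : profile n) u T : deviate S u T u = T.
Proof. by rewrite /deviate eqxx. Qed.

Lemma deviate_other n (S : profile n) u T x : x != u -> deviate S u T x = S x.
Proof. by rewrite /deviate => /negbTE ->. Qed.

Lemma nash_dev (R : realFieldType) n (w : 'I_n -> R) (alpha : R) beta (S : profile n)
    (u : 'I_n) (T : {set 'I_n}) : nash_eq w alpha beta S -> u \notin T ->
  alpha * #|S u|%:R + \sum_(v | ~~ within S beta u v) w v <=
  alpha * #|T|%:R + \sum_(v | ~~ within (deviate S u T) beta u v) w v.
Proof. by case=> _ ne uT; have := ne u T uT; rewrite /cost deviate_same. Qed.

(** [G] collects vertices that [u] gains by buying a link to [c]. The new link uses one step, which
    leaves [beta] of the [beta.+1] allowed. *)
Lemma nash_add_link (R : realFieldType) n (w : 'I_n -> R) (alpha : R) beta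
    (S : profile n) (u c : 'I_n) (G : pred 'I_n) :
  (forall v, 0 < w v) -> 0 < alpha -> nash_eq w alpha beta.+1 S -> u != c ->
  (forall v, G v -> ~~ within S beta.+1 u v && within S beta c v) ->
  \sum_(v | G v) w v <= alpha.
Proof.
move=> w0 a0 ne uc HG; have vS := proj1 ne.
have uT : u \notin c |: S u by rewrite !inE negb_or uc vS.
have sub a b : adj S a b -> adj (deviate S u (c |: S u)) a b.
  rewrite /adj /deviate.
  by case: eqP => [<-|_]; case: eqP => [<-|_]; rewrite ?inE => /orP[]->; rewrite ?orbT.
have uc' : adj (deviate S u (c |: S u)) u c.
  by rewrite /adj deviate_same !inE eqxx orbT.
have /= := nash_dev ne uT.
have : \sum_(v | G v) w v +
    \sum_(v | ~~ within (deviate S u (c |: S u)) beta.+1 u v) w v <=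
    \sum_(v | ~~ within S beta.+1 u v) w v + \sum_(v | xpred0 v) w v.
  apply: ler_sum_pred2 => // v.
  have [Gv|_] := boolP (G v).
    have /andP[-> /(within_sub sub) cv] := HG v Gv.
    by rewrite (within_step uc' cv).
  have [uv|_] := boolP (within S _ u v); last by case: (~~ _).
  by rewrite (within_sub sub uv).
rewrite big_pred0_eq.
have : alpha * #|c |: S u|%:R <= alpha * #|S u|%:R + alpha.
  rewrite -{3}[alpha]mulr1 -mulrDr natr1 ler_pM2l // ler_nat cardsU1.
  by case: (c \notin S u); rewrite ?add1n // leqW.
lra.
Qed.

(** If [p] drops its link to the leaf [x], it saves [alpha] and loses at most [x]. *)
Lemma nash_drop_leaf (R : realFieldType) n (w : 'I_n -> R) (alpha : R) beta
    (S : profile n) (x p : 'I_n) :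
  (forall v, 0 < w v) -> nash_eq w alpha beta S -> leaf S x p ->
  x \in S p -> alpha <= w x.
Proof.
move=> w0 ne lx xp; have vS := proj1 ne.
have px : p != x by apply: contraTneq xp => ->; exact: vS.
have pT : p \notin S p :\ x by rewrite !inE negb_and vS orbT.
have sub a b : a != x -> b != x -> adj S a b ->
    adj (deviate S p (S p :\ x)) a b.
  move=> ax bx; rewrite /adj /deviate.
  by case: eqP => [<-|_]; case: eqP => [<-|_]; rewrite ?inE ?ax ?bx.
have := nash_dev ne pT.
have : \sum_(v | ~~ within (deviate S p (S p :\ x)) beta p v) w v +
    \sum_(v | xpred0 v) w v <=
    \sum_(v | ~~ within S beta p v) w v + \sum_(v | v == x) w v.
  apply: ler_sum_pred2 => // v; have [->|vx] := eqVneq v x; first by case: (within _); lia.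
  have [pv|_] := boolP (within S _ p v); last by case: (~~ _).
  by rewrite (within_avoid_leaf lx sub px vx pv).
rewrite big_pred0_eq big_pred1_eq (cardsD1 x (S p)) xp natrD mulrDr mulr1.
lra.
Qed.

(* If [x] moves its only link to [q], it reaches everything [y] reaches, and
   itself in addition. *)
Lemma nash_imitate_leaf (R : realFieldType) n (w : 'I_n -> R) (alpha : R) beta
    (S : profile n) (x p y q : 'I_n) :
  (forall v, 0 < w v) -> 0 < alpha -> (1 < beta)%N ->
  nash_eq w alpha beta S -> leaf S x p -> leaf S y q ->
  p \in S x -> q \in S y -> ~~ within S beta x y ->
  \sum_(v | ~~ within S beta x v) w v + w x <=
  \sum_(v | ~~ within S beta y v) w v.
Proof.
move=> w0 a0 b1 ne lx ly px qy far; have vS := proj1 ne.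
have xy : x != y by apply: contraNneq far => ->; exact: within_refl.
have qx : q != x.
  apply: contraNneq far => qx; apply: (@within_leq _ _ 1); first exact: ltnW.
  by apply: within_step (within_refl S 0 y); rewrite adj_sym ly qx.
have xT : x \notin [set q] by rewrite inE eq_sym.
pose S' := deviate S x [set q].
have sub a b : a != x -> b != x -> adj S a b -> adj S' a b.
  by move=> ax bx; rewrite /adj /S' !deviate_other.
have xq' : adj S' x q by rewrite /adj /S' deviate_same !inE eqxx orbT.
have qy' : adj S' q y by rewrite /adj /S' [_ y]deviate_other 1?eq_sym // qy.
have sum_le : \sum_(v | ~~ within S' beta x v) w v + \sum_(v | v == x) w v <=
    \sum_(v | ~~ within S beta y v) w v + \sum_(v | xpred0 v) w v.
  apply: ler_sum_pred2 => // v; have [->|vx] := eqVneq v x.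
    rewrite within_refl /=.
    by rewrite (contra (@within_sym _ _ _ _ _) far).
  have [yv|_] := boolP (within S beta y v); last by case: (~~ _).
  suff -> : within S' beta x v by [].
  (* The vertex [y] itself is reached by [x], [q], [y]; these two steps are where [1 < beta]
     enters. *)
  have [->|vy] := eqVneq v y.
    apply: (@within_leq _ _ 2) => //; apply: within_step xq' _.
    exact: within_step qy' (within_refl _ 0 _).
  rewrite -(ltn_predK b1); apply: within_step xq' _.
  exact: (within_avoid_leaf lx sub qx vx (within_leaf ly vy yv)).
have := nash_dev ne xT; move: sum_le; rewrite -/S' big_pred0_eq big_pred1_eq cards1.
have : alpha * 1 <= alpha * #|S x|%:R.
  rewrite ler_wpM2l ?(ltW a0) // ler1n card_gt0.
  by apply/set0Pn; exists p.
lra.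
Qed.

(** Dropping one of two copies of a link saves [alpha] and leaves the graph unchanged. *)
Lemma nash_no_double_link (R : realFieldType) n (w : 'I_n -> R) (alpha : R) beta
    (S : profile n) (u v : 'I_n) :
  (forall v, 0 < w v) -> 0 < alpha -> nash_eq w alpha beta S ->
  u \in S v -> v \notin S u.
Proof.
move=> w0 a0 ne uv; apply/negP => vu; have vS := proj1 ne.
have nuv : u != v by apply: contraTneq uv => ->; exact: vS.
have uT : u \notin S u :\ v by rewrite !inE negb_and vS orbT.
have sub a b : adj S a b -> adj (deviate S u (S u :\ v)) a b.
  rewrite /adj /deviate.
  have [->|au] := eqVneq a u; have [->|bu] := eqVneq b u; rewrite ?inE //.
  - by rewrite (negbTE (vS u)).
  - by have [->|bv] := eqVneq b v => //; rewrite uv.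
  - by have [->|bv] := eqVneq a v => //; rewrite uv orbT.
have := nash_dev ne uT.
rewrite (cardsD1 v (S u)) vu natrD mulrDr mulr1.
have : \sum_(x | ~~ within (deviate S u (S u :\ v)) beta u x) w x +
    \sum_(x | xpred0 x) w x <=
    \sum_(x | ~~ within S beta u x) w x + \sum_(x | xpred0 x) w x.
  apply: ler_sum_pred2 => // x.
  have [ux|_] := boolP (within S _ u x); last by case: (~~ _).
  by rewrite (within_sub sub ux).
lra.
Qed.

(** * Diameter of a tree equilibrium *)

Lemma exists_farthest n (S : profile n) (r : 'I_n) :
  exists x, forall z, (dist S z r <= dist S x r)%N.
Proof.
by have [x _ xmax] := @arg_maxnP _ r xpredT (dist S ^~ r) isT; exists x => z; apply: xmax.
Qed.

(** Take [x] farthest from [v], then [y] farthest from [x]: distances do not shrink, and farthest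
    vertices are leaves. *)
Lemma leaf_extension n (S : profile n) (u v : 'I_n) :
  valid_profile S -> is_tree S -> u != v ->
  exists x p y q, [/\ leaf S x p, leaf S y q & (dist S u v <= dist S x y)%N].
Proof.
move=> vS tS uv; have cS := proj1 tS.
have uv0 : (0 < dist S u v)%N by rewrite lt0n dist_eq0.
have [x xmax] := exists_farthest S v; have [y ymax] := exists_farthest S x.
have le : (dist S u v <= dist S x y)%N.
  by rewrite [dist S x y]dist_sym // (leq_trans (xmax u)) // dist_sym.
have xv : x != v by rewrite -(@dist_eq0 _ S) // -lt0n (leq_trans uv0).
have yx : y != x.
  by rewrite eq_sym -(@dist_eq0 _ S) // -lt0n (leq_trans uv0).
have [p lx] := leaf_farthest vS tS xv xmax.
by have [q ly] := leaf_farthest vS tS yx ymax; exists x, p, y, q.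
Qed.

Lemma nash_tree_diameter (R : realFieldType) n (w : 'I_n -> R) (alpha : R) beta
    (S : profile n) :
  (forall v, 0 < w v) -> 0 < alpha -> (1 < beta)%N ->
  nash_eq w alpha beta S -> is_tree S ->
  forall u v, (dist S u v <= beta.+1)%N.
Proof.
move=> w0 a0 b1 ne tS u v; have vS := proj1 ne; have cS := proj1 tS.
rewrite leqNgt; apply/negP => far.
have uv : u != v by rewrite -(@dist_eq0 _ S) // -lt0n; lia.
have [x [p [y [q [lx ly]]]]] := leaf_extension vS tS uv.
move=> /(leq_trans far) {uv far u v} far.
(* If [a'] paid for the leaf [a], then [w a >= alpha], and [b] would profit from a link to [a']: it
   gains both [a] and [a'], of total weight above [alpha]. *)
have heavy a a' b b' : leaf S a a' -> leaf S b b' ->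
    (beta.+1 < dist S a b)%N -> a' \in S a.
  move=> la lb ab; have : adj S a a' by rewrite la.
  rewrite /adj => /orP[aa'|//].
  have aw := nash_drop_leaf w0 ne la aa'.
  have a'b : (beta < dist S a' b)%N.
    rewrite -ltnS (leq_trans ab) // dist_adj //.
    by rewrite la.
  have ba' : b != a' by rewrite eq_sym -(@dist_eq0 _ S) // -lt0n; lia.
  have := @nash_add_link _ _ w alpha beta.-1 S b a' (pred2 a a') w0 a0.
  rewrite (ltn_predK b1) => /(_ ne ba') Hle.
  have {}Hle : \sum_(z | pred2 a a' z) w z <= alpha.
    apply: Hle => z /pred2P[]->; rewrite !withinE // -!ltnNge dist_sym //.
      rewrite (ltn_trans _ ab) //= -withinE //.
      apply: (@within_leq _ _ 1); first by lia.
      by apply: within_step (within_refl S 0 a); rewrite adj_sym la.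
    rewrite a'b -withinE //; exact: within_refl.
  have : \sum_(z | z == a) w z + \sum_(z | z == a') w z <=
      \sum_(z | pred2 a a' z) w z + \sum_(z | xpred0 z) w z.
    apply: ler_sum_pred2 => // z /=.
    have [->|_] := eqVneq z a; last by rewrite addn0.
    have [aE|//] := eqVneq a a'.
    by move: (la a); rewrite adj_irr // -aE eqxx.
  by rewrite !big_pred1_eq big_pred0_eq; move: (w0 a') aw Hle; lra.
have px := heavy _ _ _ _ lx ly far.
have far' : (beta.+1 < dist S y x)%N by rewrite dist_sym.
have qy := heavy _ _ _ _ ly lx far'.
have nxy : ~~ within S beta x y by rewrite withinE // -ltnNge ltnW.
have nyx : ~~ within S beta y x by rewrite withinE // -ltnNge ltnW.
(* Adding the two imitation inequalities gives [w x + w y <= 0]. *)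
have := nash_imitate_leaf w0 a0 b1 ne lx ly px qy nxy.
have := nash_imitate_leaf w0 a0 b1 ne ly lx qy px nyx.
by move: (w0 x) (w0 y); lra.
Qed.

(** * Far weights in a tree equilibrium *)

Lemma nash_tree_far_weight (R : realFieldType) n (w : 'I_n -> R) (alpha : R) beta
    (S : profile n) u :
  (forall v, 0 < w v) -> 0 < alpha -> (1 < beta)%N ->
  nash_eq w alpha beta S -> is_tree S ->
  \sum_(v | ~~ within S beta u v) w v <= alpha.
Proof.
move=> w0 a0 b1 ne tS; have vS := proj1 ne; have cS := proj1 tS.
have diam := nash_tree_diameter w0 a0 b1 ne tS.
have farE v : ~~ within S beta u v -> dist S u v = beta.+1.
  by rewrite withinE // -ltnNge => ?; apply/eqP; rewrite eqn_leq diam.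
case: (pickP (fun v => ~~ within S beta u v)) => [z0 /farE uz0|none]; last first.
  by rewrite big_pred0 ?ltW.
have nuz : u != z0 by rewrite -(@dist_eq0 _ S) // uz0.
have [a ua] := dist_pred (cS u z0) nuz; rewrite uz0 => -[az0].
have naz : a != z0 by rewrite -(@dist_eq0 _ S) // -az0; lia.
have [c ac] := dist_pred (cS a z0) naz; rewrite -az0 => cz0.
have uc : u != c by apply/eqP => ucE; move: uz0; rewrite ucE; lia.
apply: (@nash_add_link _ _ w alpha beta.-1 S u c) => //.
  by rewrite (ltn_predK b1).
rewrite (ltn_predK b1) => v far; rewrite far /= withinE //.
have uv := farE v far.
have nuv : u != v by rewrite -(@dist_eq0 _ S) // uv.
(* The first step [a] is common to all far [v]: since [u] is at the maximal distance [beta.+1] from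
   [z0], no neighbour of [u] is farther from [z0], so [a'] must be [a]. *)
have av : dist S a v = beta.
  have [a' ua'] := dist_pred (cS u v) nuv; rewrite uv => -[->].
  congr (dist S _ v).
  apply: (unique_parent (r := z0) vS tS ua ua'); first by rewrite uz0 -az0.
  by rewrite uz0 diam.
have nav : a != v by rewrite -(@dist_eq0 _ S) // av; lia.
have [c' ac'] := dist_pred (cS a v) nav; rewrite av => bE.
have [->|cc'] := eqVneq c c'; first by rewrite bE.
(* Otherwise [v] and [z0] branch at [a], so they are [2 * beta] apart. *)
have c'z0 : dist S c' z0 = (dist S a z0).+1.
  by apply: (farther vS tS ac ac' cc'); rewrite -az0; lia.
have := geodesic_away vS tS ac' c'z0 (z := v); rewrite av => /(_ bE).
(* For [beta > 1], [2 * beta] exceeds the diameter bound [beta.+1]. *)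
by have := diam v z0; lia.
Qed.

(** Take [p] to be the neighbour of a leaf [x]: a vertex far from [p] would be one step farther from
    [x], beyond the diameter bound. *)
Lemma nash_tree_center (R : realFieldType) n (w : 'I_n -> R) (alpha : R) beta
    (S : profile n) :
  (forall v, 0 < w v) -> 0 < alpha -> (1 < beta)%N -> (1 < n)%N ->
  nash_eq w alpha beta S -> is_tree S ->
  exists p, forall v, within S beta p v.
Proof.
move=> w0 a0 b1 n1 ne tS; have vS := proj1 ne; have cS := proj1 tS.
pose i := Ordinal (ltnW n1); pose j := Ordinal n1.
have [|x [p [_ [_ [lx _ _]]]]] := @leaf_extension n S i j vS tS; first by [].
exists p => v; rewrite withinE // leqNgt; apply/negP => far.
have xv : x != v.
  apply: contraTneq far => <-; rewrite -leqNgt -withinE //.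
  apply: (@within_leq _ _ 1); first exact: ltnW.
  by apply: within_step (within_refl S 0 x); rewrite adj_sym lx.
have [p' ] := dist_pred (cS x v) xv; rewrite lx => /eqP-> xvE.
by have := nash_tree_diameter w0 a0 b1 ne tS x v; lia.
Qed.

(** * Counting links *)

(** Pairs are ordered as buyer and target, so a link bought from both ends counts twice, as it does
    in the cost. *)
Definition links n (S : profile n) : {set 'I_n * 'I_n} :=
  [set e : 'I_n * 'I_n | e.2 \in S e.1].

Lemma card_links n (S : profile n) : #|links S| = (\sum_u #|S u|)%N.
Proof.
transitivity (\sum_u \sum_(v in S u) 1)%N; last first.
  by apply: eq_bigr => u _; rewrite sum1_card.
by rewrite pair_big_dep /= sum1_card; apply: eq_card => e; rewrite !inE.
Qed.

(** Each link is charged to its end farther from [r]. This end determines the other one, its parent,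
    and is never [r]. *)
Lemma tree_links n (S : profile n) (r : 'I_n) :
  valid_profile S -> is_tree S ->
  (forall u v, u \in S v -> v \notin S u) -> (#|links S| <= n.-1)%N.
Proof.
move=> vS tS nodouble; have cS := proj1 tS.
have neq a b : adj S a b -> dist S a r != dist S b r.
  move=> ab; apply/eqP => E; have [ar|ar] := eqVneq a r.
    have /eqP : dist S a r == 0%N by rewrite dist_eq0 // ar.
    rewrite E => /eqP; rewrite dist_eq0 // => /eqP br.
    by move: ab; rewrite ar br adj_irr.
  have [p ap apE] := dist_pred (cS a r) ar.
  have bp : b = p by apply: (unique_parent (r := r) vS tS ab ap); [rewrite E | rewrite apE].
  by move: apE; rewrite E bp; lia.
pose f (e : 'I_n * 'I_n) := if (dist S e.1 r < dist S e.2 r)%N then e.2 else e.1.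
pose g (e : 'I_n * 'I_n) := if (dist S e.1 r < dist S e.2 r)%N then e.1 else e.2.
have fg e : e \in links S -> adj S (f e) (g e) /\ (dist S (g e) r < dist S (f e) r)%N.
  case: e => a b; rewrite inE /= /f /g /= => ab.
  have aab : adj S a b by rewrite /adj ab orbT.
  case: ltnP => [|le]; first by rewrite adj_sym.
  by split=> //; rewrite ltn_neqAle le eq_sym neq.
have inj : {in links S &, injective f}.
  move=> e e' he he' ff; have [ae de] := fg e he; have [ae' de'] := fg e' he'.
  have gg : g e = g e'.
    by rewrite -ff in ae' de'; apply: (unique_parent vS tS ae ae'); apply: ltnW; eassumption.
  case: e e' he he' ff gg {ae de ae' de'} => a b [a' b'].
  rewrite !inE /f /g /= => ab ab'.
  (* Two links with the same ends could only be opposite purchases, which [nodouble] forbids. *)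
  by do 2![case: ifP => _] => E E'; subst => //; have := nodouble _ _ ab; rewrite ab'.
rewrite -(card_in_imset inj) -[n in n.-1]card_ord -(cardsC1 r).
apply: subset_leq_card; apply/subsetP => _ /imsetP[e /fg[_ de] ->].
rewrite !inE; apply/eqP => fr; move: de; rewrite fr.
have /eqP -> // : dist S r r == 0%N by rewrite dist_eq0.
Qed.

Lemma social_costE (R : realFieldType) n (w : 'I_n -> R) (alpha : R) beta
    (S : profile n) :
  social_cost w alpha beta S =
  alpha * #|links S|%:R + \sum_u \sum_(v | ~~ within S beta u v) w v.
Proof.
by rewrite /social_cost big_split /= -mulr_sumr -natr_sum card_links.
Qed.

(** Each vertex other than the chosen root of its component is charged a link towards that root. *)
Lemma forest_links n (S : profile n) :
  (#|[set v | fingraph.root (adj S) v != v]| <= #|links S|)%N.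
Proof.
set NR := [set v | _]; pose rho := fingraph.root (adj S).
have crho v : connect (adj S) v (rho v) by exact: connect_root.
pose par v := odflt v
  [pick x | adj S v x && (dist S x (rho v) < dist S v (rho v))%N].
have parP v : v \in NR ->
    (* On [NR] the search in [par] succeeds, so the default [v] is not met. *)
    adj S v (par v) /\ (dist S (par v) (rho v) < dist S v (rho v))%N.
  rewrite inE eq_sym /par => vr; case: pickP => [x /andP[] //|none].
  have [x vx vxE] := dist_pred (crho v) vr.
  by have := none x; rewrite vx vxE ltnSn.
pose f v := if par v \in S v then (v, par v) else (par v, v).
have inj : {in NR &, injective f}.
  move=> v v' hv hv'; have [av dv] := parP v hv; have [_ dv'] := parP v' hv'.
  (* If [v] and [v'] were parents of each other, each would be strictly nearer to their common
     root. *)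
  have swap : v = par v' -> par v = v' -> v = v'.
    move=> E E'; move: dv dv'; rewrite -E E'.
    have -> : rho v' = rho v.
      by rewrite /rho; apply/esym/(fingraph.rootP (connect_adj_sym S)); rewrite -E'; exact: connect1.
    lia.
  by rewrite /f; case: ifP => _; case: ifP => _ [] // E E'; apply: swap.
rewrite -(card_in_imset inj); apply: subset_leq_card.
apply/subsetP => _ /imsetP[v hv ->]; have [av _] := parP v hv.
rewrite inE /f; case: ifP => //= nS.
by move: av; rewrite /adj nS orbF.
Qed.

(** * Lower bound on the social cost, and the ratio *)

Lemma social_cost_lower_bound (R : realFieldType) n (w : 'I_n -> R) (alpha : R) beta
    (S : profile n) :
  (forall v, 0 < w v) -> 0 < alpha -> (0 < n)%N -> alpha <= \sum_v w v ->
  alpha * n.-1%:R <= social_cost w alpha beta S.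
Proof.
move=> w0 a0 n0 aW; rewrite social_costE.
pose rho := fingraph.root (adj S); pose Rt := [set v | rho v == v].
have rhoRt v : rho v \in Rt by rewrite inE /rho root_root //; exact: connect_adj_sym.
have Rt0 : (0 < #|Rt|)%N by apply/card_gt0P; exists (rho (Ordinal n0)).
(* Summing over [v] first: the component roots other than [rho v] are players that cannot reach
   [v]. *)
have far : \sum_v w v * #|Rt|.-1%:R <=
    \sum_u \sum_(v | ~~ within S beta u v) w v.
  rewrite (exchange_big_dep xpredT) //=; apply: ler_sum => v _.
  rewrite sumr_const -[leRHS]mulr_natr ler_pM2l // ler_nat.
  rewrite (cardsD1 (rho v)) rhoRt /=; apply: subset_leq_card.
  apply/subsetP => u; rewrite !inE => /andP[uv /eqP uE].
  apply: contra uv => /within_connect /(fingraph.rootP (connect_adj_sym S)) E.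
  by rewrite -uE /rho E.
have nE : (n = #|Rt| + #|[set v | rho v != v]|)%N.
  rewrite -[LHS](card_ord n) -(cardsC Rt); congr (_ + _)%N.
  by apply: eq_card => v; rewrite !inE.
have links_le : alpha * #|[set v | rho v != v]|%:R <= alpha * #|links S|%:R.
  by rewrite ler_pM2l // ler_nat forest_links.
have : alpha * #|Rt|.-1%:R <= \sum_v w v * #|Rt|.-1%:R.
  by rewrite -mulr_suml ler_wpM2r.
have -> : n.-1 = (#|Rt|.-1 + #|[set v | rho v != v]|)%N by lia.
rewrite natrD mulrDr; lra.
Qed.

(** Some player buys a link; by dropping all its links it would save at least [alpha] and pay at
    most the total weight. *)
Lemma connected_nash_link_cost_le (R : realFieldType) n (w : 'I_n -> R) (alpha : R) beta
    (S : profile n) :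
  (forall v, 0 < w v) -> 0 < alpha -> (1 < n)%N ->
  nash_eq w alpha beta S -> connected_graph S -> alpha <= \sum_v w v.
Proof.
move=> w0 a0 n1 ne cS.
have [u Su] : exists u, S u != set0.
  pose i := Ordinal (ltnW n1); pose j := Ordinal n1.
  have [x ix _] := dist_pred (cS i j) isT.
  by case/orP: ix => [h|h]; [exists x | exists i]; apply/set0Pn; eexists; exact: h.
have uT : u \notin (set0 : {set 'I_n}) by rewrite inE.
have := nash_dev ne uT; rewrite cards0 mulr0 add0r.
have : alpha * 1 <= alpha * #|S u|%:R by rewrite ler_pM2l // ler1n card_gt0.
have : 0 <= \sum_(v | ~~ within S beta u v) w v by apply: sumr_ge0 => v _; exact: ltW.
have : \sum_(v | ~~ within (deviate S u set0) beta u v) w v + \sum_(v | xpred0 v) w v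
   <= \sum_(v | xpredT v) w v + \sum_(v | xpred0 v) w v.
  by apply: ler_sum_pred2 => // v; case: (~~ _).
rewrite big_pred0_eq; lra.
Qed.

Theorem theorem4 (R : realFieldType) (n : nat) (w : 'I_n -> R) (alpha : R)
    (beta : nat) :
  (forall u, 0 < w u) -> 0 < alpha ->
  (1 <= beta)%N -> (beta <= n.-1)%N ->
  star_celebrity_game w alpha beta ->
  (1 < beta)%N ->
  forall S : profile n, nash_eq w alpha beta S -> is_tree S ->
  forall S' : profile n, valid_profile S' ->
    social_cost w alpha beta S <= 2 * social_cost w alpha beta S'.
Proof.
move=> w0 a0 _ bn _ b1 S ne tS S' _; have n1 : (1 < n)%N by lia.
have aW := connected_nash_link_cost_le w0 a0 n1 ne (proj1 tS).
have opt := social_cost_lower_bound beta S' w0 a0 (ltnW n1) aW.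
have [p pc] := nash_tree_center w0 a0 b1 n1 ne tS.
have links_le : alpha * #|links S|%:R <= alpha * n.-1%:R.
  rewrite ler_pM2l // ler_nat (tree_links p (proj1 ne) tS) // => u v.
  exact: nash_no_double_link ne.
have far_le : \sum_u \sum_(v | ~~ within S beta u v) w v <= alpha * n.-1%:R.
  (* The player [p] has no far vertex; each of the other [n.-1] players has far weight at most
     [alpha]. *)
  rewrite (bigD1 p) //= big_pred0 => [|v]; last by rewrite pc.
  rewrite add0r.
  have -> : alpha * n.-1%:R = \sum_(u | u != p) alpha.
    by rewrite sumr_const mulr_natr cardC1 card_ord.
  by apply: ler_sum => u _; apply: nash_tree_far_weight.
rewrite social_costE; lra.
Qed.
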